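(* The set consisting of the three clauses $$\top\approx\bot \Rightarrow \emptyset, \qquad x\wedge y\approx \bot \Rightarrow x\approx \bot,\ y\approx\bot, \qquad x\vee y\approx \top \Rightarrow x\approx \top,\ y\approx\top$$ is a basis for the admissible clauses of bounded distributive lattices.
   Context: Bounded distributive lattices are considered in the language $\wedge,\vee,\bot,\top$. A clause $\Sigma\Rightarrow\Delta$ (with $\Sigma,\Delta$ finite, possibly empty, sets of identities) is satisfied by an algebra if every assignment of the variables making all identities in $\Sigma$ true makes at least one identity in $\Delta$ true (so $\Sigma\Rightarrow\emptyset$ means that no assignment makes all of $\Sigma$ true). A universal class is the class of all algebras of the language satisfying some set of clauses; $\mathbb{U}(\mathcal{K})$ is the smallest universal class containing $\mathcal{K}$. For a quasivariety $\mathcal{Q}$, $\mathbf{F}_{\mathcal{Q}}$ is its free algebra on countably infinitely many generators. A set $\Lambda$ of clauses is a basis for the admissible clauses of $\mathcal{Q}$ if $\mathbb{U}(\mathbf{F}_{\mathcal{Q}})$ is axiomatized by $\Lambda$ relative to $\mathcal{Q}$, i.e. for every algebra $\mathbf{A}$: $\mathbf{A}\in\mathbb{U}(\mathbf{F}_{\mathcal{Q}})$ iff $\mathbf{A}\in\mathcal{Q}$ and $\mathbf{A}$ satisfies all clauses in $\Lambda$. *)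

(* Defs.v *)
From HB Require Import structures.
From mathcomp Require Export all_boot finmap.
From mathcomp Require Export boolp classical_sets.

Set Implicit Arguments.
Unset Strict Implicit.
Unset Printing Implicit Defensive.

Local Open Scope fset_scope.
Local Open Scope classical_set_scope.
Local Open Scope quotient_scope.

(* An arbitrary algebra for the signature meet, join, bot, top: no lattice law
   is assumed. *)
Record algebra := Algebra {
  carrier :> Type;
  ameet : carrier -> carrier -> carrier;
  ajoin : carrier -> carrier -> carrier;
  abot : carrier;
  atop : carrier
}.

Arguments ameet {_}.
Arguments ajoin {_}.
Arguments abot {_}.
Arguments atop {_}.

(* Mathcomp's [tbDistrLatticeType] bundles the laws with a choice and order
   structure, so it is not a predicate on algebras. *)
Record bounded_distributive_lattice (A : algebra) : Prop := {
  bdl_meetA : associative (@ameet A);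
  bdl_meetC : commutative (@ameet A);
  bdl_joinA : associative (@ajoin A);
  bdl_joinC : commutative (@ajoin A);
  bdl_meetK : forall a b : A, ameet a (ajoin a b) = a;
  bdl_joinK : forall a b : A, ajoin a (ameet a b) = a;
  bdl_meetDl : left_distributive (@ameet A) (@ajoin A);
  bdl_bot : left_id abot (@ajoin A);
  bdl_top : left_id atop (@ameet A)
}.

Inductive term :=
  | Var of nat
  | Meet of term & term
  | Join of term & term
  | Bot
  | Top.

HB.instance Definition _ := gen_eqMixin term.
HB.instance Definition _ := gen_choiceMixin term.

Fixpoint eval (A : algebra) (v : nat -> A) (t : term) : A :=
  match t with
  | Var n => v n
  | Meet s t => ameet (eval v s) (eval v t)
  | Join s t => ajoin (eval v s) (eval v t)
  | Bot => abot
  | Top => atop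
  end.

Definition identity : Type := term * term.
HB.instance Definition _ := Choice.on identity.

Notation "s ≈ t" := ((s, t) : identity) (at level 70, no associativity).

Definition holds (A : algebra) (v : nat -> A) (i : identity) : Prop :=
  eval v i.1 = eval v i.2.

Record clause := Clause {
  premises : {fset identity};
  conclusions : {fset identity}
}.

Definition satisfies (A : algebra) (c : clause) : Prop :=
  forall v : nat -> A,
    (forall i, i \in premises c -> holds v i) ->
    exists2 i, i \in conclusions c & holds v i.

Definition models (Lambda : set clause) (A : algebra) : Prop :=
  forall c, Lambda c -> satisfies A c.

(* Classes of algebras are plain predicates: [set algebra] would force the
   carriers of algebras below the universe of [choiceType], ruling out the
   quotient type used for free algebras. *)
Definition universal_class (K : algebra -> Prop) : Prop :=
  exists Lambda : set clause, forall A, K A <-> models Lambda A.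

Definition universal_closure (K : algebra -> Prop) (A : algebra) : Prop :=
  forall C : algebra -> Prop,
    universal_class C -> (forall B, K B -> C B) -> C A.

(* The free algebra of Q over the generators Var 0, Var 1, ...: terms modulo the
   identities valid in Q. *)
Section FreeAlgebra.
Variable Q : algebra -> Prop.

Definition term_equiv (s t : term) : bool :=
  `[< forall A : algebra, Q A -> forall v : nat -> A, holds v (s ≈ t) >].

Lemma term_equiv_refl : reflexive term_equiv.
Proof. by move=> s; apply/asboolP. Qed.

Lemma term_equiv_sym : symmetric term_equiv.
Proof.
by move=> s t; apply/asboolP/asboolP => st A QA v; rewrite /holds st.
Qed.

Lemma term_equiv_trans : transitive term_equiv.
Proof.
move=> t s u /asboolP st /asboolP tu; apply/asboolP => A QA v.
by rewrite /holds st //; exact: tu.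
Qed.

Canonical term_equiv_equiv :=
  EquivRel term_equiv term_equiv_refl term_equiv_sym term_equiv_trans.

Definition free_carrier := {eq_quot term_equiv}.

Definition free_algebra : algebra := {|
  carrier := free_carrier;
  ameet := lift_op2 free_carrier Meet;
  ajoin := lift_op2 free_carrier Join;
  abot := lift_cst free_carrier Bot;
  atop := lift_cst free_carrier Top
|}.

Definition free_gen (n : nat) : free_algebra := \pi_free_carrier (Var n).

Lemma pi_Meet s t :
  \pi_free_carrier (Meet s t) =
  ameet (\pi s : free_algebra) (\pi t : free_algebra).
Proof.
rewrite /=; unlock; apply/eqmodP/asboolP => A QA v.
have /asboolP Es : term_equiv (repr (\pi_free_carrier s)) s.
  by apply/eqmodP; rewrite reprK.
have /asboolP Et : term_equiv (repr (\pi_free_carrier t)) t.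
  by apply/eqmodP; rewrite reprK.
by have /= := Es A QA v; have /= := Et A QA v; rewrite /holds /= => -> ->.
Qed.

Lemma pi_Join s t :
  \pi_free_carrier (Join s t) =
  ajoin (\pi s : free_algebra) (\pi t : free_algebra).
Proof.
rewrite /=; unlock; apply/eqmodP/asboolP => A QA v.
have /asboolP Es : term_equiv (repr (\pi_free_carrier s)) s.
  by apply/eqmodP; rewrite reprK.
have /asboolP Et : term_equiv (repr (\pi_free_carrier t)) t.
  by apply/eqmodP; rewrite reprK.
by have /= := Es A QA v; have /= := Et A QA v; rewrite /holds /= => -> ->.
Qed.

Lemma eval_free_gen t : eval free_gen t = \pi_free_carrier t.
Proof.
elim: t => [//|s IHs t IHt|s IHs t IHt||] /=.
- by rewrite IHs IHt pi_Meet.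
- by rewrite IHs IHt pi_Join.
- by unlock.
- by unlock.
Qed.

(* Universal property: every assignment of the generators in an algebra of Q
   extends along evaluation of terms. *)
Lemma free_extend (A : algebra) (v : nat -> A) : Q A ->
  exists h : free_algebra -> A, forall t, h (eval free_gen t) = eval v t.
Proof.
move=> QA; exists (fun q => eval v (repr (q : free_carrier))) => t.
rewrite eval_free_gen.
have /asboolP E : term_equiv (repr (\pi_free_carrier t)) t.
  by apply/eqmodP; rewrite reprK.
exact: (E A QA v).
Qed.

End FreeAlgebra.

Lemma free_bdl :
  bounded_distributive_lattice (free_algebra bounded_distributive_lattice).
Proof.
pose Q : algebra -> Prop := bounded_distributive_lattice.
have law s t (v : nat -> free_algebra Q) :
    (forall A : algebra, Q A -> forall w : nat -> A, holds w (s ≈ t)) ->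
    eval v s = eval v t.
  move=> st; pose sub := fix sub u := match u with
    | Var n => repr (v n : free_carrier Q)
    | Meet a b => Meet (sub a) (sub b)
    | Join a b => Join (sub a) (sub b)
    | Bot => Bot | Top => Top end.
  have subE (A : algebra) (w : nat -> A) u :
      eval w (sub u) = eval (fun n => eval w (sub (Var n))) u.
    by elim: u => [//|a IHa b IHb|a IHa b IHb||] //=; rewrite IHa IHb.
  have vE : v = (fun n => eval (@free_gen Q) (sub (Var n))).
    by apply/funext => n; rewrite eval_free_gen /= reprK.
  rewrite vE -!subE !eval_free_gen; apply/eqmodP/asboolP => A QA w.
  by rewrite /holds /= !subE; apply: st.
pose V (a b c : free_algebra Q) n := nth c [:: a; b; c] n.
pose x := Var 0; pose y := Var 1; pose z := Var 2.
split => [a b c|a b|a b c|a b|a b|a b|a b c|a|a].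
- apply: (law (Meet x (Meet y z)) (Meet (Meet x y) z) (V a b c)) => A QA w.
  exact: (bdl_meetA QA).
- apply: (law (Meet x y) (Meet y x) (V a b b)) => A QA w.
  exact: (bdl_meetC QA).
- apply: (law (Join x (Join y z)) (Join (Join x y) z) (V a b c)) => A QA w.
  exact: (bdl_joinA QA).
- apply: (law (Join x y) (Join y x) (V a b b)) => A QA w.
  exact: (bdl_joinC QA).
- apply: (law (Meet x (Join x y)) x (V a b b)) => A QA w.
  exact: (bdl_meetK QA).
- apply: (law (Join x (Meet x y)) x (V a b b)) => A QA w.
  exact: (bdl_joinK QA).
- apply: (law (Meet (Join x y) z) (Join (Meet x z) (Meet y z)) (V a b c)) => A QA w.
  exact: (bdl_meetDl QA).
- apply: (law (Join Bot x) x (V a a a)) => A QA w.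
  exact: (bdl_bot QA).
- apply: (law (Meet Top x) x (V a a a)) => A QA w.
  exact: (bdl_top QA).
Qed.

Definition admissible_basis (Q : algebra -> Prop) (Lambda : set clause) : Prop :=
  forall A : algebra,
    universal_closure (fun B => B = free_algebra Q) A <-> Q A /\ models Lambda A.

(* Main.v *)
Require Import Defs.
Local Open Scope classical_set_scope.
Local Open Scope fset_scope.

(** The free bounded distributive lattice consists of the monotone Boolean
functions, and the hypercube maps monotonically onto every finite poset with
least and greatest elements: send an antichain of the right size onto the poset,
the points below it to the least element and those above it to the greatest.
Dually, if a bounded distributive lattice [A] satisfies the three clauses, then
finitely many homomorphisms from [A] to the two-element lattice all factor
through a single homomorphism from [A] to the free algebra. By the prime filter
theorem, homomorphisms to the two-element lattice separate the points of [A], so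
a clause refuted in [A] is refuted in the free algebra. *)

Set Implicit Arguments.
Unset Strict Implicit.
Unset Printing Implicit Defensive.

Local Notation bdl := bounded_distributive_lattice.
Local Notation F := (free_algebra bounded_distributive_lattice).
Local Notation class_of t := (\pi_(free_carrier bdl)%qT t).

(** * Homomorphisms and the two-element lattice *)

Record hom (A B : algebra) (h : A -> B) : Prop := {
  hom_meet : {morph h : a b / ameet a b};
  hom_join : {morph h : a b / ajoin a b};
  hom_bot : h abot = abot;
  hom_top : h atop = atop
}.

Lemma hom_eval (A B : algebra) (h : A -> B) (v : nat -> A) t :
  hom h -> h (eval v t) = eval (h \o v) t.
Proof.
move=> hh; elim: t => [//|s IHs t IHt|s IHs t IHt||] /=.
- by rewrite (hom_meet hh) IHs IHt.
- by rewrite (hom_join hh) IHs IHt.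
- exact: hom_bot.
- exact: hom_top.
Qed.

Definition bool_algebra : algebra := @Algebra bool andb orb false true.

Lemma bool_bdl : bdl bool_algebra.
Proof. by split=> /=; do ![case=> //=]. Qed.

(** * Lattice order and the prime filter theorem *)

Section BoundedDistributiveLattice.
Variables (A : algebra) (QA : bdl A).
Implicit Types a b c x : A.

Definition ale a b := ameet a b = a.

Lemma meetxx a : ameet a a = a.
Proof. by rewrite -{2}[a](bdl_joinK QA a a) (bdl_meetK QA). Qed.

Lemma ale_refl a : ale a a.
Proof. exact: meetxx. Qed.

Lemma ale_trans a b c : ale a b -> ale b c -> ale a c.
Proof. by rewrite /ale => <- bc; rewrite -(bdl_meetA QA) bc. Qed.

Lemma ale_anti a b : ale a b -> ale b a -> a = b.
Proof. by rewrite /ale (bdl_meetC QA b) => -> ->. Qed.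

Lemma meet_lel a b : ale (ameet a b) a.
Proof. by rewrite /ale (bdl_meetC QA) (bdl_meetA QA) meetxx. Qed.

Lemma meet_ler a b : ale (ameet a b) b.
Proof. by rewrite /ale -(bdl_meetA QA) meetxx. Qed.

Lemma meet_glb a b c : ale c a -> ale c b -> ale c (ameet a b).
Proof. by rewrite /ale (bdl_meetA QA) => -> ->. Qed.

Lemma join_leP a b : ajoin a b = b <-> ale a b.
Proof.
split=> <-; first exact: (bdl_meetK QA).
by rewrite (bdl_joinC QA) (bdl_meetC QA) (bdl_joinK QA).
Qed.

Lemma join_gel a b : ale a (ajoin a b).
Proof. exact: (bdl_meetK QA). Qed.

Lemma join_ger a b : ale b (ajoin a b).
Proof. by rewrite (bdl_joinC QA); apply: join_gel. Qed.

Lemma join_lub a b c : ale a c -> ale b c -> ale (ajoin a b) c.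
Proof. by rewrite /ale (bdl_meetDl QA) => -> ->. Qed.

Lemma ale_top a : ale a atop.
Proof. by rewrite /ale (bdl_meetC QA) (bdl_top QA). Qed.

Lemma ale_bot a : ale abot a.
Proof. by apply/join_leP; rewrite (bdl_bot QA). Qed.

Lemma meet_ale a b c d : ale a c -> ale b d -> ale (ameet a b) (ameet c d).
Proof.
move=> ac bd; apply: meet_glb; first exact: ale_trans (meet_lel _ _) ac.
exact: ale_trans (meet_ler _ _) bd.
Qed.

(** Zorn's lemma gives a maximal filter none of whose members meets [a] below [b]. Distributivity
    makes it prime, and its characteristic function is the homomorphism. *)
Lemma prime_filter a b : ~ ale a b ->
  exists h : A -> bool_algebra, [/\ hom h, h a = true & h b = false].
Proof.
move=> nab.
(* The empty set satisfies [P], which covers the union of the empty chain; maximality later puts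
   [a], hence top, into the filter. *)
pose P (X : set A) := [/\ forall x y, X x -> X y -> X (ameet x y),
  forall x y, X x -> ale x y -> X y & forall x, X x -> ~ ale (ameet x a) b].
have [|X [[Xm Xup Xab] Xmax]] := @Zorn_bigcup A P.
  move=> C CP Ctot; split.
  - move=> x y [X CX Xx] [Y CY Yy].
    have [XY|YX] := Ctot _ _ CX CY.
      by exists Y => //; have [Ym _ _] := CP _ CY; apply: Ym => //; apply: XY.
    by exists X => //; have [Xm _ _] := CP _ CX; apply: Xm => //; apply: YX.
  - move=> x y [X CX Xx] xy; exists X => //.
    by have [_ Xup _] := CP _ CX; apply: Xup xy.
  - by move=> x [X CX Xx]; have [_ _] := CP _ CX; apply.
have ext p : ~ X p ->
    exists2 x, X x \/ x = atop & ale (ameet (ameet x p) a) b.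
  move=> nXp; apply: contrapT => nex.
  (* The filter generated by [X] and [p]; the alternative [x = atop] keeps [p] in it even if [X] is
     empty. *)
  pose Y := [set z | exists2 x, X x \/ x = atop & ale (ameet x p) z].
  apply: (Xmax Y).
    split; last by move=> /(_ p) YX; apply/nXp/YX; exists atop;
      [right|exact: meet_ler].
    by move=> x Xx; exists x; [left|exact: meet_lel].
  split.
  - move=> x y [x' Xx' x'x] [y' Xy' y'y]; exists (ameet x' y').
      case: Xx' Xy' => [Xx'|->] [Xy'|->].
      + by left; apply: Xm.
      + by left; rewrite (bdl_meetC QA) (bdl_top QA).
      + by left; rewrite (bdl_top QA).
      + by right; rewrite (bdl_top QA).
    apply: meet_glb.
      exact: ale_trans (meet_ale (meet_lel _ _) (ale_refl _)) x'x.
    exact: ale_trans (meet_ale (meet_ler _ _) (ale_refl _)) y'y.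
  - by move=> x y [z Xz zx] xy; exists z => //; apply: ale_trans xy.
  - move=> x [z Xz zx] xab; apply: nex; exists z => //.
    exact: ale_trans (meet_ale zx (ale_refl _)) xab.
have Xa : X a.
  apply: contrapT => /ext [x]; rewrite -(bdl_meetA QA) meetxx.
  by case=> [/Xab//|->]; rewrite (bdl_top QA).
have Xt : X atop by apply: Xup (ale_top a).
have {}ext p : ~ X p -> exists2 x, X x & ale (ameet (ameet x p) a) b.
  by move=> /ext [x [Xx|->] le]; [exists x|exists atop].
have nXb : ~ X b by move=> /Xab; apply; apply: meet_lel.
exists (fun x => `[< X x >]); split; [split => /=|exact/asboolP|exact/asboolP].
- move=> x y; apply/asboolP/andP.
    by move=> Xxy; split; apply/asboolP; apply: Xup Xxy _;
      [exact: meet_lel|exact: meet_ler].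
  by move=> [/asboolP Xx /asboolP Xy]; apply: Xm.
- move=> p q; apply/asboolP/orP; last first.
    by move=> [] /asboolP Xp; apply: Xup Xp _; [exact: join_gel|exact: join_ger].
  move=> Xpq; apply: contrapT => /not_orP [/negP/asboolPn nXp /negP/asboolPn nXq].
  have [x Xx xb] := ext _ nXp; have [y Xy yb] := ext _ nXq.
  (* This member of [X] distributes into a [p] part and a [q] part, each meeting [a] below [b]. *)
  apply: (Xab (ameet (ajoin p q) (ameet x y))); first by do 2?apply: (Xm).
  rewrite !(bdl_meetDl QA); apply: join_lub.
    apply: ale_trans xb; apply: meet_ale (ale_refl _).
    by rewrite (bdl_meetC QA); apply: meet_ale (meet_lel _ _) (ale_refl _).
  apply: ale_trans yb; apply: meet_ale (ale_refl _).
  by rewrite (bdl_meetC QA); apply: meet_ale (meet_ler _ _) (ale_refl _).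
- by apply/asboolP => Xbot; apply/nXb/(Xup _ _ Xbot)/ale_bot.
- exact/asboolP.
Qed.

Lemma bool_hom_separates a b : a <> b ->
  exists2 h : A -> bool_algebra, hom h & h a <> h b.
Proof.
move=> ab; have [leab|/prime_filter[h [hh ha hb]]] := pselect (ale a b); last first.
  by exists h => //; rewrite ha hb.
have /prime_filter[h [hh hb ha]] : ~ ale b a by move=> /(ale_anti leab).
by exists h => //; rewrite ha hb.
Qed.

End BoundedDistributiveLattice.

(** * The free algebra as an algebra of Boolean functions *)

(** Homomorphisms to the two-element lattice separate points, so an identity failing in some bounded
    distributive lattice already fails there. *)
Lemma term_equivE s t :
  class_of s = class_of t <->
  forall u : nat -> bool_algebra, eval u s = eval u t.
Proof.
split=> [/eqmodP /asboolP st u|st]; first exact: (st _ bool_bdl).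
apply/eqmodP/asboolP => A QA v; apply: contrapT.
move=> /(bool_hom_separates QA) [h hh]; apply.
by rewrite /= !hom_eval.
Qed.

Lemma free_bot : (abot : F) = class_of Bot.
Proof. by rewrite -eval_free_gen. Qed.

Lemma free_top : (atop : F) = class_of Top.
Proof. by rewrite -eval_free_gen. Qed.

(** Terms are monotone and the all-true assignment is the greatest one. *)
Lemma eval_xpredT_bot t : eval (fun=> true : bool_algebra) t = false ->
  forall u : nat -> bool_algebra, eval u t = false.
Proof.
move=> t0 u; elim: t t0 => [//|s IHs t IHt|s IHs t IHt|//|//] /=.
  by move=> /negbT/nandP [] /negbTE => [/IHs|/IHt] ->; rewrite ?andbF.
by move=> /norP [/negbTE/IHs-> /negbTE/IHt->].
Qed.

Lemma eval_xpred0_top t : eval (fun=> false : bool_algebra) t = true ->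
  forall u : nat -> bool_algebra, eval u t = true.
Proof.
move=> t1 u; elim: t t1 => [//|s IHs t IHt|s IHs t IHt|//|//] /=.
  by move=> /andP [/IHs-> /IHt->].
by move=> /orP [/IHs->|/IHt->]; rewrite ?orbT.
Qed.

(** * The three clauses as irreducibility of bottom and top *)

Section Irreducible.
Variable A : algebra.

Definition nontrivial := (atop : A) <> abot.
Definition bot_prime := forall a b : A, ameet a b = abot -> a = abot \/ b = abot.
Definition top_prime := forall a b : A, ajoin a b = atop -> a = atop \/ b = atop.

Lemma models_irreducible :
  models [set Clause [fset Top ≈ Bot] fset0;
    Clause [fset Meet (Var 0) (Var 1) ≈ Bot] [fset Var 0 ≈ Bot; Var 1 ≈ Bot];
    Clause [fset Join (Var 0) (Var 1) ≈ Top] [fset Var 0 ≈ Top; Var 1 ≈ Top]]%classic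
    A <-> [/\ nontrivial, bot_prime & top_prime].
Proof.
split=> [m|[nt bp tp] c].
  split=> [tb|a b ab|a b ab].
  - have [i /fset1P -> //|i] := m _ (or_introl (or_introl erefl)) (fun=> abot).
    by rewrite inE.
  - have [i /fset1P -> //|i /fset2P [] -> ?] :=
      m _ (or_introl (or_intror erefl)) (fun n => if n is 0 then a else b).
      by left.
    by right.
  - have [i /fset1P -> //|i /fset2P [] -> ?] :=
      m _ (or_intror erefl) (fun n => if n is 0 then a else b).
      by left.
    by right.
move=> [[]|] -> v /= prem.
- by have /nt := prem _ (fset11 _).
- have /bp [] := prem _ (fset11 _) => e; [exists (Var 0 ≈ Bot)|exists (Var 1 ≈ Bot)] => //.
    exact: fset21.
  exact: fset22.
- have /tp [] := prem _ (fset11 _) => e; [exists (Var 0 ≈ Top)|exists (Var 1 ≈ Top)] => //.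
    exact: fset21.
  exact: fset22.
Qed.

End Irreducible.

(** A meet that is false at the all-true assignment has a factor false there, hence everywhere;
    joins use the all-false assignment dually. *)
Lemma free_irreducible : [/\ nontrivial F, bot_prime F & top_prime F].
Proof.
split.
- by rewrite /nontrivial free_bot free_top => /term_equivE /(_ (fun=> true)).
- move=> a b; rewrite free_bot -[a]reprK -[b]reprK -pi_Meet => /term_equivE.
  move=> /(_ (fun=> true)) /= /negbT/nandP [] /negbTE/eval_xpredT_bot e;
    [left|right]; exact/term_equivE.
- move=> a b; rewrite free_top -[a]reprK -[b]reprK -pi_Join => /term_equivE.
  move=> /(_ (fun=> false)) /= /orP [] /eval_xpred0_top e;
    [left|right]; exact/term_equivE.
Qed.

(** * Factoring finitely many homomorphisms through the free algebra *)

Section Factor.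
Variables (A : algebra) (QA : bdl A).
Hypotheses (nt : nontrivial A) (bp : bot_prime A) (tp : top_prime A).

(** The greatest homomorphism to the two-element lattice: it replaces the constant true, which fails
    only at bottom. Dually, [eq_top_hom] replaces the constant false. *)
Lemma neq_bot_hom : hom (fun a : A => `[< a <> abot >] : bool_algebra).
Proof.
split=> [a b|a b||] /=.
- apply/asboolP/andP => [ab|[/asboolP a0 /asboolP b0] /bp [//|//]].
  split; apply/asboolP => e; apply: ab; rewrite e; first exact: ale_bot.
  by rewrite (bdl_meetC QA); apply: ale_bot.
- apply/asboolP/orP => [ab|[] /asboolP a0 e].
  + apply: contrapT => /not_orP [/negP/asboolPn/contrapT a0 /negP/asboolPn/contrapT b0].
    by apply: ab; rewrite a0 b0 (bdl_bot QA).
  + by apply: a0; apply: (ale_anti QA) (ale_bot QA _); rewrite -e; apply: join_gel.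
  + by apply: a0; apply: (ale_anti QA) (ale_bot QA _); rewrite -e; apply: join_ger.
- by apply/asboolP; apply.
- exact/asboolP.
Qed.

Lemma eq_top_hom : hom (fun a : A => `[< a = atop >] : bool_algebra).
Proof.
split=> [a b|a b||] /=.
- apply/asboolP/andP => [e|[/asboolP-> /asboolP->]]; last exact: (bdl_top QA).
  split; apply/asboolP; apply: (ale_anti QA) (ale_top QA _) _; rewrite -e.
    exact: meet_lel.
  exact: meet_ler.
- apply/asboolP/orP => [/tp [] ->|[] /asboolP->].
  + by left; apply/asboolP.
  + by right; apply/asboolP.
  + by apply: (ale_anti QA) (ale_top QA _) _; apply: join_gel.
  + by apply: (ale_anti QA) (ale_top QA _) _; apply: join_ger.
- by apply/asboolP => /esym.
- exact/asboolP.
Qed.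

Variables (I : eqType) (h : I -> A -> bool_algebra).

(* A median: as the values of the fresh variables [Var n] and [Var n.+1] vary,
   [separator n (i :: l) a] is false, true, [h i a] or [separator n.+2 l a]. *)
Fixpoint separator (n : nat) (l : seq I) (a : A) : term :=
  if l is i :: l' then
    Join (Meet (Var n) (Var n.+1))
      (Join (Meet (Var n) (separator n.+2 l' a))
            (Meet (Var n.+1) (if h i a then Top else Bot)))
  else Bot.

(** The selecting variables depend on [u] alone, so one alternative serves all [a] at once. *)
Lemma separator_cases n l (u : nat -> bool_algebra) :
  [\/ forall a, eval u (separator n l a) = false,
      forall a, eval u (separator n l a) = true |
      exists i, forall a, eval u (separator n l a) = h i a].
Proof.
elim: l n => [|i l IHl] n; first by constructor 1.
have hE a : eval u (if h i a then Top else Bot) = h i a by case: (h i a).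
rewrite /=; case: (u n) (u n.+1) => [] [] /=.
- by constructor 2.
- have [H|H|[j H]] := IHl n.+2; [constructor 1|constructor 2|constructor 3] => [a|a|].
  + by rewrite H.
  + by rewrite H.
  + by exists j => a; rewrite H orbF.
- by constructor 3; exists i => a; rewrite hE.
- by constructor 1.
Qed.

(* The agreement with [u0] below [n] is what lets the induction fix the
   selecting variables [Var n] and [Var n.+1]. *)
Lemma separator_select n l i (u0 : nat -> bool_algebra) : i \in l ->
  exists u : nat -> bool_algebra,
    (forall m, m < n -> u m = u0 m) /\
    forall a, eval u (separator n l a) = h i a.
Proof.
elim: l n u0 => [//|j l IHl] n u0; rewrite inE.
have [->|_ /= il] := eqVneq i j.
  (* [Var n] false and [Var n.+1] true select the head; the opposite values, used below, pass on to
     the tail. *)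
  exists (fun m => if m < n then u0 m else m == n.+1); split=> [m ->//|a] /=.
  by rewrite ltnn ltnNge leqnSn eqxx ltn_eqF //=; case: (h j a).
have [u [uE uh]] := IHl n.+2 (fun m => if m < n then u0 m else m == n) il.
exists u; split=> [m mn|a].
  by rewrite uE ?mn // ltnW // ltnW.
rewrite uh uE // uE ?ltnSn // ltnn eqxx ltnNge leqnSn gtn_eqF //=.
by rewrite orbF.
Qed.

(** Correcting [separator] at bottom and top turns its constant values false and true into the maps
    of [eq_top_hom] and [neq_bot_hom], and leaves a homomorphism [h i] unchanged. *)
Definition factor (l : seq I) (a : A) : term :=
  if `[< a = abot >] then Bot else if `[< a = atop >] then Top
  else separator 0 l a.

Hypothesis h_hom : forall i, hom (h i).

Lemma factor_hom l (u : nat -> bool_algebra) :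
  hom (fun a => eval u (factor l a)).
Proof.
have [H|H|[i H]] := separator_cases 0 l u.
- rewrite [X in hom X](_ : _ = fun a => `[< a = atop >]); first exact: eq_top_hom.
  apply/funext => a; rewrite /factor.
  case: asboolP => [->|_]; first by apply/esym/asboolP => /esym.
  by case: asboolP => //= _; rewrite H.
- rewrite [X in hom X](_ : _ = fun a => `[< a <> abot >]); first exact: neq_bot_hom.
  apply/funext => a; rewrite /factor asbool_neg.
  case: asboolP => //= _; by case: asboolP => //= _; rewrite H.
- rewrite [X in hom X](_ : _ = h i) //.
  apply/funext => a; rewrite /factor.
  case: asboolP => [->|_]; first by rewrite (hom_bot (h_hom i)).
  by case: asboolP => [->|_]; rewrite ?(hom_top (h_hom i)).
Qed.

Lemma factor_select l i : i \in l ->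
  exists u : nat -> bool_algebra, forall a, eval u (factor l a) = h i a.
Proof.
move=> il; have [u [_ uh]] := @separator_select 0 l i (fun=> false) il.
exists u => a; rewrite /factor.
case: asboolP => [->|_]; first by rewrite (hom_bot (h_hom i)).
by case: asboolP => [->|_]; rewrite ?(hom_top (h_hom i)).
Qed.

Lemma free_factor_hom l :
  hom (fun a => class_of (factor l a) : F).
Proof.
split=> [a b|a b||].
- by rewrite -pi_Meet; apply/term_equivE => u; rewrite (hom_meet (factor_hom l u)).
- by rewrite -pi_Join; apply/term_equivE => u; rewrite (hom_join (factor_hom l u)).
- by rewrite free_bot; apply/term_equivE => u; rewrite (hom_bot (factor_hom l u)).
- by rewrite free_top; apply/term_equivE => u; rewrite (hom_top (factor_hom l u)).
Qed.

End Factor.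

(** If all conclusions fail in [A], pick for each a homomorphism separating its sides. The common
    factor [phi] carries the premises to [F], where some conclusion then holds; selecting its
    homomorphism pulls that equality back, a contradiction. *)
Lemma satisfies_free (A : algebra) (c : clause) :
  bdl A -> nontrivial A -> bot_prime A -> top_prime A ->
  satisfies F c -> satisfies A c.
Proof.
move=> QA nt bp tp Fc v prem; apply: contrapT => nconcl.
have /choice[h hP] (i : identity) : exists h : A -> bool_algebra,
    hom h /\ (~ holds v i -> h (eval v i.1) <> h (eval v i.2)).
  have [vi|/(bool_hom_separates QA)[h hh hi]] := pselect (holds v i).
    (* An arbitrary default for identities that hold under [v]. *)
    by exists (fun a => `[< a <> abot >]); split=> //; apply: neq_bot_hom.
  by exists h.
have h_hom i : hom (h i) by have [] := hP i.
pose phi a : F := class_of (factor h (conclusions c) a).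
have phi_hom : hom phi by exact: free_factor_hom.
have [i /prem|i ic] := Fc (phi \o v).
  by rewrite /holds -!hom_eval // => ->.
rewrite /holds -!hom_eval // => /term_equivE phi_i.
have [_ hi] := hP i; apply: hi => [vi|]; first by apply: nconcl; exists i.
have [u uh] := factor_select h_hom ic.
by rewrite -!uh.
Qed.

(** * Lattice laws as clauses, and the basis *)

Definition bdl_identities : seq identity :=
  let x := Var 0 in let y := Var 1 in let z := Var 2 in
  [:: Meet x (Meet y z) ≈ Meet (Meet x y) z; Meet x y ≈ Meet y x;
      Join x (Join y z) ≈ Join (Join x y) z; Join x y ≈ Join y x;
      Meet x (Join x y) ≈ x; Join x (Meet x y) ≈ x;
      Meet (Join x y) z ≈ Join (Meet x z) (Meet y z);
      Join Bot x ≈ x; Meet Top x ≈ x].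

(* Indices past the end only contribute the trivial identity [Top ≈ Top]. *)
Definition bdl_clauses : set clause :=
  range (fun k => Clause fset0 [fset nth (Top ≈ Top) bdl_identities k]).

Lemma models_bdl_clauses (A : algebra) : models bdl_clauses A <-> bdl A.
Proof.
split=> [m|QA c [k _ <-] v _].
  have law k (a b c : A) :
      holds (nth c [:: a; b; c]) (nth (Top ≈ Top) bdl_identities k).
    by have [//|i /fset1P ->] := m _ (imageT _ k) (nth c [:: a; b; c]).
  split=> [a b c|a b|a b c|a b|a b|a b|a b c|a|a].
  - exact: (law 0 a b c).
  - exact: (law 1 a b b).
  - exact: (law 2 a b c).
  - exact: (law 3 a b b).
  - exact: (law 4 a b b).
  - exact: (law 5 a b b).
  - exact: (law 6 a b c).
  - exact: (law 7 a a a).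
  - exact: (law 8 a a a).
exists (nth (Top ≈ Top) bdl_identities k); first exact: fset11.
case: QA => mA mC jA jC mK jK mD b t.
by rewrite /holds; do 9?[case: k => [|k] //=]; case: k.
Qed.

Theorem theorem15 :
  let x := Var 0 in
  let y := Var 1 in
  admissible_basis bounded_distributive_lattice
    [set Clause [fset Top ≈ Bot] fset0;
         Clause [fset Meet x y ≈ Bot] [fset x ≈ Bot; y ≈ Bot];
         Clause [fset Join x y ≈ Top] [fset x ≈ Top; y ≈ Top]]%classic.
Proof.
move=> x y A; split=> [UA|[QA /models_irreducible [nt bp tp]] C [Lambda CE] CF].
  pose L := [set Clause [fset Top ≈ Bot] fset0;
         Clause [fset Meet x y ≈ Bot] [fset x ≈ Bot; y ≈ Bot];
         Clause [fset Join x y ≈ Top] [fset x ≈ Top; y ≈ Top]]%classic.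
  (* This class is universal, axiomatized by the lattice laws together with [L], and contains the
     free algebra. *)
  apply: (UA (fun B => bdl B /\ models L B)).
    exists (bdl_clauses `|` L)%classic => B; split=> [[/models_bdl_clauses mQ mL]|m].
      by move=> c [/mQ|/mL].
    split; first by apply/models_bdl_clauses => c cQ; apply: m; left.
    by move=> c cL; apply: m; right.
  move=> B ->; split; first exact: free_bdl.
  exact/models_irreducible/free_irreducible.
(* Each clause axiomatizing [C] holds in the free algebra and so passes to [A]. *)
apply/CE => c Lc; apply: satisfies_free => //.
by have /CE := CF _ erefl; apply.
Qed.
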